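(* Assume that $H_1$ is true, i.e. $\mathbf X$ and $\mathbf Y$ are not conditionally independent given $\mathbf Z$ under the distribution $P$ of $(\mathbf X,\mathbf Y,\mathbf Z)$, and that the conditional distribution of $\mathbf X$ given $\mathbf Z$ is $P_{\mathbf X\mid\mathbf Z}$. Let $\mathbf X^{(1)}$ be copies of $\mathbf X$ generated using an estimate $Q^{(n)}_{\mathbf X\mid\mathbf Z}$ of the true conditional distribution $P_{\mathbf X\mid\mathbf Z}$. Also assume that $$d_{\mathrm{TV}}\Big(\prod_{i=1}^nQ^{(n)}_{\mathbf X\mid\mathbf Z_i},\ \prod_{i=1}^nP_{\mathbf X\mid\mathbf Z_i}\Big)\to0\quad\text{in probability as }n\to\infty .$$ Then $\hat\zeta^{(1)}_{n,\sigma}$, the statistic computed based on $\{(\mathbf X_i,\mathbf X_i^{(1)},\mathbf Y_i,\mathbf Z_i)\}_{i=1}^n$, converges in probability to $\zeta_\sigma(P)$ (defined with the exact null exchangeable pair) as $n\to\infty$.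
   Context: $\{(\mathbf X_i,\mathbf Y_i,\mathbf Z_i)\}_{i=1}^n$ is an i.i.d. sample from $P$ on $\mathbb R^d$; $d_{\mathrm{TV}}(Q_1,Q_2)=\sup_A|Q_1(A)-Q_2(A)|$. Instead of assuming knowledge of $P_{\mathbf X\mid\mathbf Z}$, an approximation $Q^{(n)}_{\mathbf X\mid\mathbf Z}$ is used: $\mathbf X_i^{(1)}\sim Q^{(n)}_{\mathbf X\mid\mathbf Z_i}$ for $i=1,\dots,n$. For example, $Q^{(n)}_{\mathbf X\mid\mathbf Z}$ may be an estimate of $P_{\mathbf X\mid\mathbf Z}$ constructed either from the same data or from an auxiliary unlabeled sample $\{(\mathbf X_i^*,\mathbf Z_i^* )\}_{i=1}^N$ drawn from the joint distribution of $(\mathbf X,\mathbf Z)$. Fix $\sigma^2>0$ and $K(\mathbf x,\mathbf y)=\exp\{-\sigma^2\|\mathbf x-\mathbf y\|^2/2\}$. With $\mathbf V_i=(\mathbf X_i,\mathbf Y_i,\mathbf Z_i)$ and $\mathbf V_i^{(1)}=(\mathbf X_i^{(1)},\mathbf Y_i,\mathbf Z_i)$, $$\hat\zeta^{(1)}_{n,\sigma}=\binom n2^{-1}\sum_{1\le i<j\le n}\big\{K(\mathbf V_i,\mathbf V_j)+K(\mathbf V_i^{(1)},\mathbf V_j^{(1)})-K(\mathbf V_i,\mathbf V_j^{(1)})-K(\mathbf V_i^{(1)},\mathbf V_j)\big\}.$$ The target is $\zeta_\sigma(P)=\mathbb E[K(\mathbf V_1,\mathbf V_2)]+\mathbb E[K(\mathbf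 V_1',\mathbf V_2')]-2\mathbb E[K(\mathbf V_1,\mathbf V_2')]$, where $\mathbf V_1,\mathbf V_2$ are independent copies of $(\mathbf X,\mathbf Y,\mathbf Z)\sim P$ and $\mathbf V_i'=(\mathbf X_i',\mathbf Y_i,\mathbf Z_i)$ is the exact null exchangeable pair of $\mathbf V_i$: $\mathbf X_i'$ is drawn from the true conditional distribution $P_{\mathbf X\mid\mathbf Z_i}$, so that $\mathbf X_i'\mid\mathbf Z_i$ has the same distribution as $\mathbf X_i\mid\mathbf Z_i$, and $\mathbf X_i'$ is conditionally independent of $\mathbf Y_i$ given $\mathbf Z_i$; the draws are independent across $i$. *)

(* Defs.v *)
From HB Require Import structures.
From mathcomp Require Import all_boot all_order all_algebra finmap.
From mathcomp Require Import all_classical all_reals all_analysis.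

Set Implicit Arguments.
Unset Strict Implicit.
Unset Printing Implicit Defensive.

Import Order.TTheory GRing.Theory Num.Theory.
Import numFieldNormedType.Exports.

Local Open Scope classical_set_scope.
Local Open Scope ring_scope.

Section product_of_probabilities.
Context {d : measure_display} {T : measurableType d} {R : realType}.

Definition tuple_cons n (p : T * n.-tuple T) : n.+1.-tuple T :=
  [the n.+1.-tuple T of p.1 :: p.2].

Lemma measurable_tuple_cons n : measurable_fun setT (@tuple_cons n).
Proof. exact: measurable_cons. Qed.

HB.instance Definition _ n := isMeasurableFun.Build _ _ _ _ (@tuple_cons n)
  (@measurable_tuple_cons n).

Fixpoint prod_prob n : ('I_n -> probability T R) -> probability (n.-tuple T) R :=
  match n return ('I_n -> probability T R) -> probability (n.-tuple T) R with
  | 0 => fun _ => \d_([tuple] : 0.-tuple T)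
  | m.+1 => fun mu =>
      distribution
        (product_measure1 (mu ord0) (prod_prob (fun i => mu (lift ord0 i))))
        (@tuple_cons m)
  end.

Lemma prod_prob_rect n (mu : 'I_n -> probability T R) (A : 'I_n -> set T) :
  (forall i, measurable (A i)) ->
  prod_prob mu [set t | forall i, A i (tnth t i)] = (\prod_(i < n) mu i (A i))%E.
Proof.
elim: n mu A => [|n IH] mu A mA.
  rewrite big_ord0 /= diracE (_ : _ \in _)//.
  by apply/mem_set => -[].
rewrite big_ord_recl /= /distribution /pushforward.
rewrite (_ : _ @^-1` _ = A ord0 `*`
    [set t | forall i, A (lift ord0 i) (tnth t i)]); last first.
  apply/seteqP; split => [[x t] /= H|[x t] /= [Hx Ht] i].
    split => /= [|i]; first by have := H ord0.
    by have := H (lift ord0 i); rewrite tnthS.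
  by case: (unliftP ord0 i) => [j ->|->]; rewrite ?tnthS//; exact: Ht.
have mA' : measurable [set t : n.-tuple T |
    forall i, A (lift ord0 i) (tnth t i)].
  rewrite (_ : [set _ | _] = \bigcap_(i : 'I_n)
      ((fun t : n.-tuple T => tnth t i) @^-1` A (lift ord0 i))); last first.
    by apply/seteqP; split => [t H i _|t H i]; apply: H.
  apply: fin_bigcap_measurable => [|i _]; first exact: finite_finset.
  by rewrite -[X in measurable X]setTI; exact: measurable_tnth.
rewrite product_measure1E//=; congr (_ * _)%E.
exact: (IH (fun i => mu (lift ord0 i)) (fun i => A (lift ord0 i))).
Qed.

End product_of_probabilities.

(* A probability kernel evaluated at a point, as a [probability]. *)
Section kernel_probability.
Context {d d' : measure_display} {T : measurableType d} {T' : measurableType d'}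
  {R : realType}.
Variables (k : R.-pker T ~> T') (x : T).

Definition kernel_prob : set T' -> \bar R := k x.

HB.instance Definition _ := Measure.on kernel_prob.
HB.instance Definition _ := Measure_isProbability.Build _ _ _ kernel_prob
  (prob_kernel x).

End kernel_probability.

Section probability_notions.
Context {d : measure_display} {T : measurableType d} {R : realType}.

Definition dTV (mu nu : probability T R) : R :=
  sup [set `|fine (mu A) - fine (nu A)| | A in measurable].

(* The outer measure [mu_ext P] agrees with [P] on measurable sets; it makes the
   notion meaningful when the measurability of [f n] has not been established,
   as for a total variation distance, which is an uncountable supremum. *)
Definition cvg_in_probability (P : probability T R) (f : nat -> T -> R) (l : R) :=
  forall e : R, 0 < e ->
    mu_ext P [set w | e < `|f n w - l|] @[n --> \oo] --> 0%E.

Definition iid_with_law {d'} {T' : measurableType d'} (P : probability T R)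
    (V : nat -> {RV P >-> T'}) (law : probability T' R) :=
  (forall i A, measurable A -> distribution P (V i) A = law A) /\
  (forall (J : {fset nat}) (A : nat -> set T'), (forall i, measurable (A i)) ->
    P (\bigcap_(i in [set` J]) V i @^-1` A i) =
    (\prod_(i <- J) P (V i @^-1` A i))%E).

(* [g] is a version of [z |-> P(E | Z = z)]. *)
Definition is_cond_prob {d'} {TZ : measurableType d'} (P : probability T R)
    (Z : T -> TZ) (E : set T) (g : TZ -> R) :=
  [/\ measurable_fun setT g,
      P.-integrable setT (fun t => (g (Z t))%:E) &
      forall C, measurable C ->
        P (E `&` Z @^-1` C) = (\int[P]_(t in Z @^-1` C) (g (Z t))%:E)%E].

(* [P(X \in A, Y \in B | Z) = P(X \in A | Z) P(Y \in B | Z)] almost surely, for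
   all measurable [A] and [B]. *)
Definition cond_independent {d1 d2 d3} {TX : measurableType d1}
    {TY : measurableType d2} {TZ : measurableType d3} (P : probability T R)
    (X : T -> TX) (Y : T -> TY) (Z : T -> TZ) :=
  forall A B, measurable A -> measurable B ->
  forall gA gB gAB : TZ -> R,
    is_cond_prob P Z (X @^-1` A) gA ->
    is_cond_prob P Z (Y @^-1` B) gB ->
    is_cond_prob P Z (X @^-1` A `&` Y @^-1` B) gAB ->
  {ae P, forall t, gAB (Z t) = gA (Z t) * gB (Z t)}.

Definition is_cond_dist {d1 d2} {TX : measurableType d1} {TZ : measurableType d2}
    (P : probability T R) (X : T -> TX) (Z : T -> TZ) (k : R.-pker TZ ~> TX) :=
  forall A C, measurable A -> measurable C ->
    P (X @^-1` A `&` Z @^-1` C) = (\int[P]_(t in Z @^-1` C) k (Z t) A)%E.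

(* Conditionally on [W], the components of [X] are independent and [X_i] has law
   [mu _ i]; [mu] is meant to depend on the sample point through [W] only. *)
Definition drawn_given {d1 d2} {TW : measurableType d1} {TX : measurableType d2}
    (P : probability T R) (W : T -> TW) n (X : T -> n.-tuple TX)
    (mu : T -> 'I_n -> probability TX R) :=
  forall A B, measurable A -> measurable B ->
    P (W @^-1` A `&` X @^-1` B) =
    (\int[P]_(t in W @^-1` A) prod_prob (mu t) B)%E.

End probability_notions.

(* An observation [(x, y, z)] stands for the concatenated vector of
   R^(dx + dy + dz); the sigma-algebra on tuples, generated by the coordinates,
   is the Borel one. *)
Notation obs R dx dy dz := (dx.-tuple R * dy.-tuple R * dz.-tuple R)%type.

Section kernel_statistic.
Context {R : realType} {dx dy dz : nat}.
Local Notation obs := (obs R dx dy dz).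

Definition obsX (v : obs) := v.1.1.
Definition obsY (v : obs) := v.1.2.
Definition obsZ (v : obs) := v.2.

Definition with_x (v : obs) (x : dx.-tuple R) : obs := (x, obsY v, obsZ v).

(* Squared Euclidean distance (the norm of the library is the sup norm). *)
Definition sqdist n (u v : n.-tuple R) : R :=
  \sum_(i < n) (tnth u i - tnth v i) ^+ 2.

Definition gauss_kernel (sigma : R) (v w : obs) : R :=
  expR (- (sigma ^+ 2 * (sqdist (obsX v) (obsX w) + sqdist (obsY v) (obsY w) +
                         sqdist (obsZ v) (obsZ w)) / 2)).

Definition zeta_hat (sigma : R) n (V : n.-tuple obs)
    (X1 : n.-tuple (dx.-tuple R)) : R :=
  let K := gauss_kernel sigma in
  let V0 i := tnth V i in
  let V1 i := with_x (tnth V i) (tnth X1 i) in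
  ('C(n, 2)%:R)^-1 *
  \sum_(i < n) \sum_(j < n | (i < j)%N)
    (K (V0 i) (V0 j) + K (V1 i) (V1 j) - K (V0 i) (V1 j) - K (V1 i) (V0 j)).

Local Open Scope ereal_scope.

(* [E[f(V')]] for [V' = (X', Y, Z)] with [(X, Y, Z) ~ P] and, conditionally on
   [(X, Y, Z)], [X' ~ PXZ Z]. *)
Definition null_expectation (P : probability obs R)
    (PXZ : R.-pker dz.-tuple R ~> dx.-tuple R) (f : obs -> \bar R) : \bar R :=
  \int[P]_v \int[PXZ (obsZ v)]_x f (with_x v x).

(* The pairs [(V_1, V_1')] and [(V_2, V_2')] being independent, each expectation
   is an iterated integral. *)
Definition zeta (sigma : R) (P : probability obs R)
    (PXZ : R.-pker dz.-tuple R ~> dx.-tuple R) : R :=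
  let K v w := (gauss_kernel sigma v w)%:E in
  let E' := null_expectation P PXZ in
  fine (\int[P]_v \int[P]_w K v w
        + E' (fun v => E' (fun w => K v w))
        - 2%:E * \int[P]_v E' (fun w => K v w)).

End kernel_statistic.

(* Main.v *)
Require Import Defs.
From HB Require Import structures.
From mathcomp Require Import all_boot all_order all_algebra finmap.
From mathcomp Require Import all_classical all_reals all_analysis.
From mathcomp Require Import measurable_realfun ring lra.

(** The idea is to separate the sampling noise of the U-statistic, which is
    handled by a variance bound valid under any product law, from the error made
    by drawing from the estimated conditional law.

    Condition on the data. The draws [X1] have the product law built from [QXZ],
    and the event that [zeta_hat] misses its target by more than [e] has, up to
    the total variation distance, the same conditional probability under the
    product law built from the true [PXZ]; outside an event of small probability
    this costs little ([le_dTV], [mu_ext_measurable_cover]). The comparison is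
    between conditional laws given the data, so it does not matter how the
    estimate depends on the sample. Averaging over the data is legitimate because
    the conditional law determines the joint law of the data and the draws
    ([joint_prob_family]).

    Under the true product law two concentration arguments remain. Given the
    sample, [zeta_hat] is a function of independent draws which moves by O(1/n)
    when one draw changes, so its conditional variance is O(1/n), and its
    conditional mean is again a U-statistic, with kernel [cond_energy], in the
    sample alone. The sample has a product law too ([sample_law]), so the same
    bound concentrates this second U-statistic around its mean, which Fubini and
    the symmetry of the Gaussian kernel identify with [zeta]
    ([mean_cond_energy]).

    Both steps are instances of [ustat_concentration], whose kernels may depend
    on the pair of indices: this absorbs the conditioning on the sample. It rests
    on [variance_bounded_differences], the inequality Var F <= n c^2 for functions
    of n independent variables with differences bounded by c, which follows by
    induction on n from the recursive construction of the product measure. *)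

Set Implicit Arguments.
Unset Strict Implicit.
Unset Printing Implicit Defensive.

Import Order.TTheory GRing.Theory Num.Theory.
Import numFieldNormedType.Exports.

Local Open Scope classical_set_scope.
Local Open Scope ring_scope.

(** * Means of bounded measurable functions *)

Section bounded_measurable_functions.
Context {R : realType}.

(** Every function below is of this kind, which makes integrability automatic and
    is stable under all the operations used, partial integration included. *)
Definition bdd_mfun {d} {T : measurableType d} (f : T -> R) : Prop :=
  measurable_fun setT f /\ exists M, forall x, `|f x| <= M.

Context {d : measure_display} {T : measurableType d}.
Implicit Types f g : T -> R.

Lemma bdd_mfun_cst (c : R) : bdd_mfun (fun _ : T => c).
Proof. by split => //; exists `|c|. Qed.

Lemma bdd_mfunD f g :
  bdd_mfun f -> bdd_mfun g -> bdd_mfun (fun x => f x + g x).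
Proof.
move=> [mf [M fM]] [mg [N gN]]; split; first exact: measurable_funD.
by exists (M + N) => x; rewrite (le_trans (ler_normD _ _))// lerD.
Qed.

Lemma bdd_mfunN f : bdd_mfun f -> bdd_mfun (fun x => - f x).
Proof.
move=> [mf [M fM]]; split; first exact: measurableT_comp.
by exists M => x; rewrite normrN.
Qed.

Lemma bdd_mfunB f g :
  bdd_mfun f -> bdd_mfun g -> bdd_mfun (fun x => f x - g x).
Proof. by move=> bf bg; apply: bdd_mfunD => //; exact: bdd_mfunN. Qed.

Lemma bdd_mfunM f g :
  bdd_mfun f -> bdd_mfun g -> bdd_mfun (fun x => f x * g x).
Proof.
move=> [mf [M fM]] [mg [N gN]]; split; first exact: measurable_funM.
by exists (M * N) => x; rewrite normrM ler_pM.
Qed.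

Lemma bdd_mfunX f n : bdd_mfun f -> bdd_mfun (fun x => f x ^+ n).
Proof.
move=> bf; elim: n => [|n IH]; first exact: bdd_mfun_cst.
by under eq_fun do rewrite exprS; exact: bdd_mfunM.
Qed.

Lemma bdd_mfun_sum (I : Type) (s : seq I) (Q : pred I) (F : I -> T -> R) :
  (forall i, bdd_mfun (F i)) -> bdd_mfun (fun x => \sum_(i <- s | Q i) F i x).
Proof.
move=> bF; elim: s => [|i s IH].
  by under eq_fun do rewrite big_nil; exact: bdd_mfun_cst.
under eq_fun do rewrite big_cons.
by case: (Q i) => //; exact: bdd_mfunD.
Qed.

Lemma bdd_mfun_comp {d'} {T' : measurableType d'} (f : T -> R) (h : T' -> T) :
  bdd_mfun f -> measurable_fun setT h -> bdd_mfun (fun x => f (h x)).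
Proof.
move=> [mf [M fM]] mh; split; last by exists M.
exact: (measurableT_comp mf mh).
Qed.

Lemma bdd_mfun_indic (A : set T) : measurable A -> bdd_mfun (\1_A : T -> R).
Proof.
move=> mA; split; first exact: measurable_indic.
by exists 1 => x; rewrite indicE; case: (_ \in _); rewrite ?normr1 ?normr0.
Qed.

Variable P : probability T R.

Lemma bdd_mfun_integrable f : bdd_mfun f -> P.-integrable setT (EFin \o f).
Proof.
move=> [mf [M fM]]; apply: measurable_bounded_integrable => //.
  by rewrite -ge0_fin_numE// fin_num_measure.
exists M; split => [|N MN x _ /=]; first exact: num_real.
by rewrite (le_trans (fM x))// ltW.
Qed.

Lemma EFin_Rintegral f : bdd_mfun f ->
  (\int[P]_x (f x)%:E)%E = (\int[P]_x f x)%:E.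
Proof.
by move=> bf; rewrite /Rintegral fineK//; exact/integrable_fin_num/bdd_mfun_integrable.
Qed.

Lemma mean_cst (c : R) : \int[P]_x c = c.
Proof. by rewrite Rintegral_cst//=; rewrite (@probability_setT _ _ _ P) mulr1. Qed.

Lemma meanD f g : bdd_mfun f -> bdd_mfun g ->
  \int[P]_x (f x + g x) = \int[P]_x f x + \int[P]_x g x.
Proof. by move=> bf bg; apply: RintegralD => //; exact: bdd_mfun_integrable. Qed.

Lemma meanB f g : bdd_mfun f -> bdd_mfun g ->
  \int[P]_x (f x - g x) = \int[P]_x f x - \int[P]_x g x.
Proof. by move=> bf bg; apply: RintegralB => //; exact: bdd_mfun_integrable. Qed.

(** The shape of the energy kernel: four terms, two with each sign. *)
Lemma mean_DBB f1 f2 f3 f4 : bdd_mfun f1 -> bdd_mfun f2 ->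
    bdd_mfun f3 -> bdd_mfun f4 ->
  \int[P]_x (f1 x + f2 x - f3 x - f4 x) =
  \int[P]_x f1 x + \int[P]_x f2 x - \int[P]_x f3 x - \int[P]_x f4 x.
Proof.
move=> b1 b2 b3 b4; have b12 := bdd_mfunD b1 b2.
by rewrite (meanB (bdd_mfunB b12 b3) b4) (meanB b12 b3) (meanD b1 b2).
Qed.

Lemma meanZ (c : R) f : bdd_mfun f -> \int[P]_x (c * f x) = c * \int[P]_x f x.
Proof. by move=> bf; apply: RintegralZl => //; exact: bdd_mfun_integrable. Qed.

Lemma mean_sum (I : Type) (s : seq I) (Q : pred I) (F : I -> T -> R) :
  (forall i, bdd_mfun (F i)) ->
  \int[P]_x (\sum_(i <- s | Q i) F i x) = \sum_(i <- s | Q i) \int[P]_x F i x.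
Proof.
move=> bF; elim: s => [|i s IH].
  by rewrite big_nil; under eq_Rintegral do rewrite big_nil; exact: mean_cst.
rewrite big_cons; under eq_Rintegral do rewrite big_cons.
by case: (Q i) => //; rewrite meanD// ?IH//; exact: bdd_mfun_sum.
Qed.

Lemma le_mean f g : bdd_mfun f -> bdd_mfun g -> (forall x, f x <= g x) ->
  \int[P]_x f x <= \int[P]_x g x.
Proof. by move=> bf bg fg; apply: le_Rintegral => //; exact: bdd_mfun_integrable. Qed.

Lemma mean_norm_le f M : bdd_mfun f -> (forall x, `|f x| <= M) ->
  `|\int[P]_x f x| <= M.
Proof.
move=> bf fM; rewrite ler_norml; apply/andP; split.
- rewrite -(mean_cst (- M)); apply: le_mean => //; first exact: bdd_mfun_cst.
  by move=> x; have := fM x; rewrite ler_norml => /andP[].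
- rewrite -[leRHS](mean_cst M); apply: le_mean => //; first exact: bdd_mfun_cst.
  by move=> x; have := fM x; rewrite ler_norml => /andP[].
Qed.

Lemma mean_dist_le f c M : bdd_mfun f -> (forall x, `|f x - c| <= M) ->
  `|\int[P]_x f x - c| <= M.
Proof.
move=> bf fM; rewrite -[X in _ - X](mean_cst c) -meanB//; last exact: bdd_mfun_cst.
by apply: mean_norm_le => //; apply: bdd_mfunB => //; exact: bdd_mfun_cst.
Qed.

(** The bias-variance decomposition of a mean square deviation. *)
Lemma mean_sq_dev f c : bdd_mfun f ->
  \int[P]_x (f x - c) ^+ 2 =
  \int[P]_x (f x - \int[P]_y f y) ^+ 2 + (\int[P]_y f y - c) ^+ 2.
Proof.
move=> bf; set m := \int[P]_y f y.
have bd : bdd_mfun (fun x => f x - m) by apply: bdd_mfunB => //; exact: bdd_mfun_cst.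
rewrite (_ : (fun x => (f x - c) ^+ 2) = fun x =>
    (f x - m) ^+ 2 + (2 * (m - c) * (f x - m) + (m - c) ^+ 2)); last first.
  by apply/funext => x; ring.
rewrite meanD; [|exact: bdd_mfunX|]; last first.
  by apply: bdd_mfunD; [apply: bdd_mfunM => //|]; exact: bdd_mfun_cst.
congr (_ + _).
rewrite meanD; [|by apply: bdd_mfunM => //; exact: bdd_mfun_cst|exact: bdd_mfun_cst].
rewrite meanZ// meanB//; last exact: bdd_mfun_cst.
by rewrite !mean_cst subrr mulr0 add0r.
Qed.

Lemma mean_indic (A : set T) : measurable A -> (\int[P]_x \1_A x)%:E = P A.
Proof.
move=> mA; rewrite -EFin_Rintegral; last exact: bdd_mfun_indic.
by rewrite integral_indic// setIT.
Qed.

Lemma bdd_mfun_chebyshev f (e : R) : bdd_mfun f -> 0 < e ->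
  (P [set x | (e <= `|f x|)%R] <= (\int[P]_x (f x ^+ 2) / e ^+ 2)%:E)%E.
Proof.
move=> bf e0.
have mA : measurable [set x | e <= `|f x|].
  rewrite (_ : mkset _ = (Num.norm \o f) @^-1` [set` `[e, +oo[]); last first.
    by apply/seteqP; split => x /=; rewrite in_itv/= andbT.
  rewrite -[X in measurable X]setTI.
  have mnf : measurable_fun setT (Num.norm \o f) by apply: measurableT_comp; case: bf.
  exact: mnf.
rewrite -mean_indic// lee_fin ler_pdivlMr ?exprn_gt0// mulrC.
rewrite -meanZ; last exact: bdd_mfun_indic.
apply: le_mean.
- by apply: bdd_mfunM; [exact: bdd_mfun_cst|exact: bdd_mfun_indic].
- exact: bdd_mfunX.
move=> x; rewrite indicE; have [|] := boolP (x \in _).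
  rewrite inE/= mulr1 => ex.
  by rewrite -[leRHS]real_normK ?num_real// lerXn2r// nnegrE// ltW.
by rewrite mulr0 sqr_ge0.
Qed.

End bounded_measurable_functions.

Section mean_transfer.
Context {R : realType} {d1 d2 : measure_display}
  {T1 : measurableType d1} {T2 : measurableType d2}.

Lemma mean_distribution (P : probability T1 R) (X : {mfun T1 >-> T2})
    (f : T2 -> R) : bdd_mfun f ->
  \int[distribution P X]_y f y = \int[P]_x f (X x).
Proof.
move=> bf; congr fine; rewrite integral_distribution//.
- by apply/measurable_EFinP; case: bf.
- exact: (bdd_mfun_integrable P (bdd_mfun_comp bf (measurable_funPT X))).
Qed.

Variables (P1 : probability T1 R) (P2 : probability T2 R).

Lemma mean_prod (f : T1 * T2 -> R) : bdd_mfun f ->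
  \int[(P1 \x P2)%E]_z f z = \int[P1]_x \int[P2]_y f (x, y).
Proof.
move=> bf; congr fine.
have intf := bdd_mfun_integrable (P1 \x P2)%E bf.
rewrite -(integral12_prod_meas1 intf); apply: eq_integral => x _.
rewrite /fubini_F -EFin_Rintegral//.
by apply: bdd_mfun_comp => //; exact: pair1_measurable.
Qed.

Lemma mean_swap (f : T1 * T2 -> R) : bdd_mfun f ->
  \int[P1]_x \int[P2]_y f (x, y) = \int[P2]_y \int[P1]_x f (x, y).
Proof.
move=> bf; rewrite -mean_prod//; congr fine.
have intf := bdd_mfun_integrable (P1 \x P2)%E bf.
rewrite -(integral21_prod_meas1 intf); apply: eq_integral => y _.
rewrite /fubini_G -EFin_Rintegral//.
by apply: bdd_mfun_comp => //; exact: pair2_measurable.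
Qed.

End mean_transfer.

(** * Measurable families of probabilities *)

Section probability_family.
Context {R : realType} {d1 d2 : measure_display}
  {T1 : measurableType d1} {T2 : measurableType d2}.

Definition measurable_family (k : T1 -> probability T2 R) : Prop :=
  forall U, measurable U -> measurable_fun setT (fun x => k x U).

Variables (k : T1 -> probability T2 R) (mk : measurable_family k).

(** Families such as [w |-> prod_prob (mu w)] are functions into [probability];
    this repackages them as kernels, to which the integration lemmas apply. *)
Definition family_kernel of measurable_family k : T1 -> {measure set T2 -> \bar R} :=
  fun x => k x.

HB.instance Definition _ := @isKernel.Build _ _ T1 T2 R (family_kernel mk) mk.

HB.instance Definition _ := @Kernel_isProbability.Build _ _ T1 T2 R
  (family_kernel mk) (fun x => probability_setT (k x)).

Lemma measurable_family_xsection (A : set (T1 * T2)) : measurable A ->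
  measurable_fun setT (fun x => k x (xsection A x)).
Proof.
move=> mA.
exact: (measurable_fun_xsection_finite_kernel (family_kernel mk) (mem_set mA)).
Qed.

(** Measurability of a parametrized integral is available for nonnegative
    integrands: shift by the bound, then subtract it. *)
Lemma bdd_mfun_mean_family (f : T1 * T2 -> R) : bdd_mfun f ->
  bdd_mfun (fun x => \int[k x]_y f (x, y)).
Proof.
move=> bf; have [mf [M fM]] := bf.
have bfx x : bdd_mfun (fun y => f (x, y)).
  by apply: bdd_mfun_comp => //; exact: pair1_measurable.
split; last by exists M => x; exact: mean_norm_le.
have bg : bdd_mfun (fun z => f z + M) by apply: bdd_mfunD => //; exact: bdd_mfun_cst.
rewrite (_ : (fun x => _) = fun x => \int[k x]_y (f (x, y) + M) - M); last first.
  by apply/funext => x; rewrite meanD ?mean_cst ?addrK//; exact: bdd_mfun_cst.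
apply: measurable_funB => //.
apply: (measurableT_comp (fine_measurable measurableT)).
apply: (@measurable_fun_integral_finite_kernel _ _ _ _ _
  (fun z => (f z + M)%:E) (family_kernel mk)).
- move=> z; rewrite lee_fin -lerBlDr sub0r.
  by have := fM z; rewrite ler_norml => /andP[].
- by apply/measurable_EFinP; case: bg.
Qed.

End probability_family.

Lemma bdd_mfun_mean2 {R : realType} {d1 d2} {T1 : measurableType d1}
    {T2 : measurableType d2} (P : probability T2 R) (f : T1 * T2 -> R) :
  bdd_mfun f -> bdd_mfun (fun x => \int[P]_y f (x, y)).
Proof.
by apply: (bdd_mfun_mean_family (k := fun=> P)) => U mU; exact: measurable_cst.
Qed.

(** * Product probabilities on tuples *)

Section tuple_rectangles.
Context {d : measure_display} {T : measurableType d} {n : nat}.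

Definition rectangle (A : 'I_n -> set T) : set (n.-tuple T) :=
  [set t | forall i, A i (tnth t i)].

Definition rectangles : set (set (n.-tuple T)) :=
  [set rectangle A | A in [set A | forall i, measurable (A i)]].

Lemma measurable_rectangle A : (forall i, measurable (A i)) ->
  measurable (rectangle A).
Proof.
move=> mA; rewrite (_ : rectangle A =
    \bigcap_(i : 'I_n) ((fun t : n.-tuple T => tnth t i) @^-1` A i)); last first.
  by apply/seteqP; split => [t H i _|t H i]; apply: H.
apply: fin_bigcap_measurable => [|i _]; first exact: finite_finset.
by rewrite -[X in measurable X]setTI; exact: measurable_tnth.
Qed.

Lemma rectangle_setT : rectangle (fun=> setT) = setT.
Proof. by apply/seteqP; split. Qed.

Lemma setI_closed_rectangles : setI_closed rectangles.
Proof.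
move=> _ _ [A mA <-] [B mB <-]; exists (fun i => A i `&` B i) => [i|].
  by apply: measurableI; [exact: mA|exact: mB].
by apply/seteqP; split => [t H|t [HA HB] i]; [split => i; have [] := H i|split].
Qed.

Lemma measurable_tuple_rectangles :
  @measurable _ (n.-tuple T) = <<s rectangles >>.
Proof.
apply/seteqP; split; last first.
  apply: smallest_sub; first exact: sigma_algebra_measurable.
  by move=> _ [A mA <-]; exact: measurable_rectangle.
apply: smallest_sub; first exact: smallest_sigma_algebra.
rewrite -bigcup_seq => _ [i /= _ [B mB <-]].
apply: sub_sigma_algebra; exists (fun j => if j == i then B else setT) => [j /=|].
  by case: ifP.
rewrite setTI; apply/seteqP; split => [t /(_ i)|t Bt j].
  by rewrite eqxx.
by case: eqVneq => // ->.
Qed.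

End tuple_rectangles.

Section product_probability.
Context {R : realType} {d : measure_display} {T : measurableType d}.

Lemma prod_prob_unique n (mu : 'I_n -> probability T R)
    (nu : probability (n.-tuple T) R) :
  (forall A : 'I_n -> set T, (forall i, measurable (A i)) ->
    nu (rectangle A) = (\prod_(i < n) mu i (A i))%E) ->
  forall B, measurable B -> nu B = prod_prob mu B.
Proof.
move=> nuE B mB.
apply: (measure_unique rectangles (fun=> setT)) => //.
- exact: measurable_tuple_rectangles.
- exact: setI_closed_rectangles.
- by move=> _; exists (fun=> setT) => //; exact: rectangle_setT.
- by apply/seteqP; split => // x _; exists 0%N.
- by move=> _ [A mA <-]; exact: (etrans (nuE A mA) (esym (prod_prob_rect mu mA))).
- by move=> _; rewrite -ge0_fin_numE// fin_num_measure.
Qed.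

Lemma measurable_family_prod_prob {d'} {W : measurableType d'} n
    (mu : W -> 'I_n -> probability T R) :
  (forall i, measurable_family (mu ^~ i)) ->
  measurable_family (fun w => prod_prob (mu w)).
Proof.
move=> mmu B mB.
have : <<s @rectangles _ T n >> B by rewrite -measurable_tuple_rectangles.
move: B {mB}; apply: (dynkin_induction
  (P := fun B => measurable_fun setT (fun w => prod_prob (mu w) B))).
- exact: measurable_tuple_rectangles.
- exact: setI_closed_rectangles.
- by under eq_fun do rewrite probability_setT; exact: measurable_cst.
- move=> _ [A mA <-]; under eq_fun do rewrite prod_prob_rect//.
  elim: (index_enum _) => [|i s IH].
    by under eq_fun do rewrite big_nil; exact: measurable_cst.
  under eq_fun do rewrite big_cons.
  by apply: emeasurable_funM => //; exact: mmu.
- move=> S mS mf; under eq_fun do rewrite probability_setC//.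
  by apply: emeasurable_funB.
- move=> F mF tF mFn.
  rewrite (_ : (fun _ => _) = fun w => (\sum_(0 <= k <oo) prod_prob (mu w) (F k))%E).
    exact: ge0_emeasurable_sum.
  by apply/funext => w; rewrite measure_semi_bigcup//; exact: bigcup_measurable.
Qed.

(** The recursive construction of the product law gives Fubini for the first
    coordinate against the others: the induction step of the variance bound. *)
Lemma mean_prod_prob_cons n (mu : 'I_n.+1 -> probability T R)
    (F : n.+1.-tuple T -> R) : bdd_mfun F ->
  \int[prod_prob mu]_t F t =
  \int[mu ord0]_x \int[prod_prob (fun i => mu (lift ord0 i))]_t
     F (tuple_cons (x, t)).
Proof.
move=> bF; rewrite /= mean_distribution// mean_prod//.
by apply: bdd_mfun_comp => //; exact: measurable_tuple_cons.
Qed.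

Lemma mean_pair {d0 d1 d2} {Om : measurableType d0} {T1 : measurableType d1}
    {T2 : measurableType d2} (P : probability Om R) (X : Om -> T1) (Y : Om -> T2)
    (m1 : probability T1 R) (m2 : probability T2 R) (f : T1 * T2 -> R) :
  measurable_fun setT X -> measurable_fun setT Y ->
  (forall A B, measurable A -> measurable B ->
    P (X @^-1` A `&` Y @^-1` B) = (m1 A * m2 B)%E) ->
  bdd_mfun f ->
  \int[P]_w f (X w, Y w) = \int[m1]_x \int[m2]_y f (x, y).
Proof.
move=> mX mY PXY bf.
have mXY : measurable_fun setT (fun w => (X w, Y w)) by exact: measurable_fun_pair.
pose H := isMeasurableFun.Build _ _ _ _ _ mXY.
pose XY : {mfun Om >-> (T1 * T2)%type} := HB.pack (fun w => (X w, Y w)) H.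
rewrite -mean_prod// -(mean_distribution P XY)//; congr fine.
by apply: eq_measure_integral => A mA _; apply/esym/product_measure_unique.
Qed.

Lemma mean_prod_prob_pair n (mu : 'I_n -> probability T R) (i j : 'I_n)
    (f : T * T -> R) : i != j -> bdd_mfun f ->
  \int[prod_prob mu]_t f (tnth t i, tnth t j) =
  \int[mu i]_x \int[mu j]_y f (x, y).
Proof.
move=> ij bf.
apply: (mean_pair (X := fun t => tnth t i) (Y := fun t => tnth t j)) => //;
  [exact: measurable_tnth|exact: measurable_tnth|].
move=> A B mA mB.
pose C k := if k == i then A else if k == j then B else setT.
rewrite (_ : _ `&` _ = rectangle C); last first.
  apply/seteqP; split => [t [/= At Bt] k|t Ct].
    by rewrite /C; case: eqVneq => [->//|_]; case: eqVneq => [->|].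
  split => /=; first by have := Ct i; rewrite /C eqxx.
  by have := Ct j; rewrite /C eqxx eq_sym (negbTE ij).
rewrite prod_prob_rect; last by move=> k; rewrite /C; do 2 case: ifP => // _.
rewrite (bigD1 i)//= (bigD1 j) 1?eq_sym//= big1; last first.
  by move=> k /andP[ki kj]; rewrite /C (negbTE ki) (negbTE kj) probability_setT.
by rewrite mule1 /C !eqxx eq_sym (negbTE ij).
Qed.

End product_probability.

(** A conditional law known on rectangles determines the joint law: both sides
    are measures of [S], and rectangles form a generating pi-system. *)
Lemma joint_prob_family {R : realType} {d1 d2 d3} {Om : measurableType d1}
    {T1 : measurableType d2} {T2 : measurableType d3} (P : probability Om R)
    (W : Om -> T1) (X : Om -> T2) (k : T1 -> probability T2 R) :
  measurable_fun setT W -> measurable_fun setT X -> measurable_family k ->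
  (forall A B, measurable A -> measurable B ->
    P (W @^-1` A `&` X @^-1` B) = (\int[P]_(w in W @^-1` A) k (W w) B)%E) ->
  forall S, measurable S ->
    P [set w | S (W w, X w)] = (\int[P]_w k (W w) (xsection S (W w)))%E.
Proof.
move=> mW mX mk WX.
have mWX : measurable_fun setT (fun w => (W w, X w)) by exact: measurable_fun_pair.
have mpre (S : set (T1 * T2)) : measurable S -> measurable [set w | S (W w, X w)].
  by move=> mS; rewrite -[X in measurable X]setTI; exact: mWX.
have msec (S : set (T1 * T2)) : measurable S ->
    measurable_fun setT (fun w => k (W w) (xsection S (W w))).
  by move=> mS; exact: (measurableT_comp (measurable_family_xsection mk mS) mW).
have mxs (S : set (T1 * T2)) x : measurable S -> measurable (xsection S x).
  by move=> mS; exact: measurable_xsection.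
move=> S mS.
have : <<s [set A `*` B | A in @measurable _ T1 & B in @measurable _ T2] >> S.
  by rewrite -measurable_prod_measurableType.
move: S {mS}; apply: (dynkin_induction (P := fun S : set (T1 * T2) =>
  P [set w | S (W w, X w)] = (\int[P]_w k (W w) (xsection S (W w)))%E)).
- exact: measurable_prod_measurableType.
- move=> _ _ [A1 mA1 [A2 mA2 <-]] [B1 mB1 [B2 mB2 <-]].
  exists (A1 `&` B1); first exact: measurableI.
  by exists (A2 `&` B2); [exact: measurableI|rewrite setXI].
- rewrite (_ : mkset _ = setT)// probability_setT.
  under eq_integral do rewrite xsectionE preimage_setT probability_setT.
  by rewrite integral_cst//= (@probability_setT _ _ _ P) mule1.
- move=> _ [A mA [B mB <-]].
  rewrite (_ : mkset _ = W @^-1` A `&` X @^-1` B)// WX// integral_mkcond.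
  apply: eq_integral => w _; rewrite patchE; case: ifPn => [|].
    by rewrite inE => Aw; rewrite in_xsectionX// inE.
  by rewrite notin_setE => Aw; rewrite notin_xsectionX ?measure0// notin_setE.
- move=> S mS PS.
  rewrite (_ : mkset _ = ~` [set w | S (W w, X w)])//.
  have := probability_setC P (mpre _ mS); rewrite PS => ->.
  have fS : (\int[P]_w k (W w) (xsection S (W w)))%E \is a fin_num.
    by rewrite -PS fin_num_measure//; exact: mpre.
  rewrite -[RHS](addeK _ fS) -ge0_integralD//; last 2 first.
  + by apply: msec; exact: measurableC.
  + exact: msec.
  under [X in _ = (X - _)%E]eq_integral => w _.
    have -> : xsection (~` S) (W w) = ~` xsection S (W w).
      by rewrite !xsectionE.
    rewrite probability_setC; last exact: mxs.
    rewrite subeK; last by rewrite fin_num_measure//; exact: mxs.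
    over.
  by rewrite integral_cst//= (@probability_setT _ _ _ P) mule1.
- move=> F mF tF PF.
  rewrite (_ : mkset _ = \bigcup_n [set w | F n (W w, X w)])//.
  rewrite measure_semi_bigcup//; first last.
  + by apply: bigcup_measurable => n _; exact: mpre.
  + move=> i j _ _ [w [Fi Fj]]; apply: (tF i j) => //.
    by exists (W w, X w).
  + by move=> n; exact: mpre.
  rewrite (eq_eseriesr (fun n _ => PF n)).
  rewrite -integral_nneseries//; last by move=> n; exact: msec.
  apply: eq_integral => w _.
  rewrite xsection_bigcup measure_semi_bigcup//.
  + by move=> n; exact: mxs.
  + exact: trivIset_xsection.
  + by apply: bigcup_measurable => n _; exact: mxs.
Qed.

(** * Concentration of functions of independent variables *)

Section concentration.
Context {R : realType} {d : measure_display} {T : measurableType d}.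

Definition bounded_differences n (F : n.-tuple T -> R) (c : R) : Prop :=
  forall (i : 'I_n) t t', (forall j, j != i -> tnth t j = tnth t' j) ->
  `|F t - F t'| <= c.

Lemma tnth_tuple_cons0 n x (t : n.-tuple T) : tnth (tuple_cons (x, t)) ord0 = x.
Proof. by []. Qed.

Lemma tnth_tuple_consS n x (t : n.-tuple T) j :
  tnth (tuple_cons (x, t)) (lift ord0 j) = tnth t j.
Proof. exact: tnthS. Qed.

(** Conditionally on the first coordinate, F has n-1 coordinates left and the
    induction hypothesis applies; the conditional mean of F is a function M of the
    first coordinate whose oscillation is at most c, hence contributes at most c^2
    to the variance. *)
Lemma variance_bounded_differences n (mu : 'I_n -> probability T R)
    (F : n.-tuple T -> R) (c : R) : bdd_mfun F -> bounded_differences F c ->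
  \int[prod_prob mu]_t (F t - \int[prod_prob mu]_s F s) ^+ 2 <= n%:R * c ^+ 2.
Proof.
elim: n mu F => [|n IH] mu F bF Fc.
  (* all 0-tuples are equal *)
  rewrite (_ : F = cst (F [tuple])); last by apply/funext => t; rewrite tuple0.
  rewrite mean_cst; under eq_Rintegral do rewrite subrr expr0n.
  by rewrite mean_cst mul0r.
set a := \int[prod_prob mu]_s F s.
pose mu' i := mu (lift ord0 i).
have bFx x : bdd_mfun (fun t => F (tuple_cons (x, t))).
  by apply: (bdd_mfun_comp (bdd_mfun_comp bF (@measurable_tuple_cons _ _ _)));
    exact: pair1_measurable.
pose M x := \int[prod_prob mu']_t F (tuple_cons (x, t)).
have bM : bdd_mfun M.
  apply: (bdd_mfun_mean2 (prod_prob mu') (f := fun z => F (tuple_cons z))).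
  by apply: bdd_mfun_comp => //; exact: measurable_tuple_cons.
have aM : a = \int[mu ord0]_x M x by rewrite /a mean_prod_prob_cons.
have bdev (b : R) : bdd_mfun (fun t => (F t - b) ^+ 2).
  by apply: bdd_mfunX; apply: bdd_mfunB => //; exact: bdd_mfun_cst.
rewrite mean_prod_prob_cons//.
have MM x y : `|M x - M y| <= c.
  rewrite /M -meanB//; apply: mean_norm_le; first exact: bdd_mfunB.
  move=> t; apply: (Fc ord0) => j j0.
  by case: (unliftP ord0 j) j0 => [k ->|->]; rewrite ?tnth_tuple_consS ?eqxx.
rewrite -[leRHS](mean_cst (mu ord0)).
have bI : bdd_mfun (fun x => \int[prod_prob mu']_t (F (tuple_cons (x, t)) - a) ^+ 2).
  apply: (bdd_mfun_mean2 (prod_prob mu') (f := fun z => (F (tuple_cons z) - a) ^+ 2)).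
  by apply: (bdd_mfun_comp (bdev a)); exact: measurable_tuple_cons.
apply: le_mean => //; first exact: bdd_mfun_cst.
move=> x; rewrite mean_sq_dev//.
rewrite -natr1 mulrDl mul1r lerD//.
  apply: IH => // i t t' tt'.
  apply: (Fc (lift ord0 i)) => j; case: (unliftP ord0 j) => [k ->|-> _]; last first.
    by rewrite !tnth_tuple_cons0.
  by rewrite (inj_eq lift_inj) => ki; rewrite !tnth_tuple_consS tt'.
have aMc : `|M x - a| <= c.
  by rewrite distrC aM; apply: mean_dist_le.
rewrite -[leLHS]real_normK ?num_real// lerXn2r// nnegrE//.
exact: le_trans aMc.
Qed.

Lemma chebyshev_bounded_differences n (mu : 'I_n -> probability T R)
    (F : n.-tuple T -> R) (c e : R) :
  bdd_mfun F -> bounded_differences F c -> 0 < e ->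
  (prod_prob mu [set t | (e <= `|F t - \int[prod_prob mu]_s F s|)%R] <=
     (n%:R * c ^+ 2 / e ^+ 2)%:E)%E.
Proof.
move=> bF Fc e0.
have bd : bdd_mfun (fun t => F t - \int[prod_prob mu]_s F s).
  by apply: bdd_mfunB => //; exact: bdd_mfun_cst.
apply: (le_trans (bdd_mfun_chebyshev (prod_prob mu) bd e0)).
rewrite lee_fin ler_pM2r ?invr_gt0 ?exprn_gt0//.
exact: variance_bounded_differences.
Qed.

(** The kernel may depend on the indices, so that a U-statistic conditioned on
    part of its arguments is again of this form. *)
Definition ustat n (h : 'I_n -> 'I_n -> T * T -> R) (t : n.-tuple T) : R :=
  'C(n, 2)%:R^-1 *
  \sum_(i < n) \sum_(j < n | (i < j)%N) h i j (tnth t i, tnth t j).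

Section ustat.
Variables (n : nat) (h : 'I_n -> 'I_n -> T * T -> R) (M : R).
Hypotheses (mh : forall i j, measurable_fun setT (h i j))
  (hM : forall i j z, `|h i j z| <= M).

Let bh i j : bdd_mfun (h i j).
Proof. by split=> //; exists M. Qed.

Let bhij i j : bdd_mfun (fun t : n.-tuple T => h i j (tnth t i, tnth t j)).
Proof.
by apply: bdd_mfun_comp => //; apply: measurable_fun_pair; exact: measurable_tnth.
Qed.

Lemma bdd_mfun_ustat : bdd_mfun (ustat h).
Proof.
apply: bdd_mfunM; first exact: bdd_mfun_cst.
by do 2 (apply: bdd_mfun_sum => ?).
Qed.

(** At most 2 n of the ordered pairs (i, j) involve the modified
    coordinate k, and each such term moves by at most 2 M. *)
Lemma bounded_differences_ustat :
  bounded_differences (ustat h) ('C(n, 2)%:R^-1 * (4 * M * n%:R)).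
Proof.
move=> k t t' tt'; rewrite /ustat -mulrBr normrM ger0_norm ?invr_ge0//.
rewrite ler_wpM2l ?invr_ge0//.
rewrite -sumrB; apply: (le_trans (ler_norm_sum _ _ _)).
(* [b i + b j] is at least 1 when the pair (i, j) involves k *)
pose b (i : 'I_n) : R := (i == k)%:R.
have M0 (i j : 'I_n) (z : T * T) : 0 <= M by rewrite (le_trans _ (hM i j z)).
have bE : \sum_(i < n) b i = 1.
  rewrite (bigD1 k)//= big1 ?addr0 /b ?eqxx// => i /negbTE ik.
  by rewrite ik.
apply: (@le_trans _ _ (\sum_(i < n) \sum_(j < n) 2 * M * (b i + b j))).
  apply: ler_sum => i _; rewrite -sumrB; apply: (le_trans (ler_norm_sum _ _ _)).
  rewrite big_mkcond/=; apply: ler_sum => j _.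
  have Mij : 0 <= M by exact: (M0 i j (tnth t i, tnth t j)).
  have b0 (l : 'I_n) : 0 <= b l by [].
  case: ifP => _; last by rewrite !mulr_ge0// addr_ge0.
  have [/eqP ik|ik] := boolP (i == k); last first.
    have [/eqP jk|jk] := boolP (j == k); last first.
      by rewrite !tt'// subrr normr0 !mulr_ge0// addr_ge0.
    apply: (le_trans (ler_normB _ _)).
    apply: (le_trans (lerD (hM _ _ _) (hM _ _ _))).
    rewrite (_ : M + M = 2 * M); [|by ring]; rewrite ler_peMr ?mulr_ge0//.
    by rewrite /b jk eqxx lerDr.
  apply: (le_trans (ler_normB _ _)).
  apply: (le_trans (lerD (hM _ _ _) (hM _ _ _))).
  rewrite (_ : M + M = 2 * M); [|by ring]; rewrite ler_peMr ?mulr_ge0//.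
  by rewrite /b ik eqxx lerDl.
rewrite le_eqVlt; apply/orP; left; apply/eqP.
transitivity (2 * M * \sum_(i < n) (n%:R * b i + 1)).
  rewrite mulr_sumr; apply: eq_bigr => i _; rewrite -mulr_sumr; congr (_ * _).
  by rewrite big_split/= bE sumr_const card_ord mulr_natl.
rewrite big_split/= -mulr_sumr bE sumr_const card_ord.
by rewrite mulr1; ring.
Qed.

Lemma mean_ustat (mu : 'I_n -> probability T R) :
  \int[prod_prob mu]_t ustat h t =
  'C(n, 2)%:R^-1 * \sum_(i < n) \sum_(j < n | (i < j)%N)
    \int[mu i]_x \int[mu j]_y h i j (x, y).
Proof.
rewrite meanZ; last by do 2 (apply: bdd_mfun_sum => ?).
congr (_ * _); rewrite mean_sum; last by move=> i; apply: bdd_mfun_sum.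
apply: eq_bigr => i _; rewrite mean_sum//.
apply: eq_bigr => j ij; rewrite mean_prod_prob_pair//.
by rewrite -val_eqE/= neq_ltn ij.
Qed.

End ustat.

(** The differences are c = 8 M / (n-1) and n <= 2 (n-1), so that
    n c^2 <= 128 M^2 / (n-1); the number of variables is written n.+2. *)
Lemma ustat_concentration n (h : 'I_n.+2 -> 'I_n.+2 -> T * T -> R) (M e : R)
    (mu : 'I_n.+2 -> probability T R) :
  (forall i j, measurable_fun setT (h i j)) ->
  (forall i j z, `|h i j z| <= M) -> 0 < e ->
  (prod_prob mu [set t | (e <= `|ustat h t - \int[prod_prob mu]_s ustat h s|)%R] <=
     (128 * M ^+ 2 / e ^+ 2 / n.+1%:R)%:E)%E.
Proof.
move=> mh hM e0.
apply: (le_trans (chebyshev_bounded_differences mu (bdd_mfun_ustat mh hM)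
  (bounded_differences_ustat hM) e0)).
have CE : 'C(n.+2, 2)%:R = n.+2%:R * n.+1%:R / 2 :> R.
  have := mul_bin_diag n.+2 1; rewrite bin1 => /(congr1 (fun k => k%:R : R)).
  by rewrite !natrM => ->; rewrite mulrC mulKf.
rewrite lee_fin CE -[n.+2%:R]natr1.
have a1 : 1 <= n.+1%:R :> R by rewrite ler1n.
move: (n.+1%:R) a1 => a a1.
have a0 : 0 < a by lra.
rewrite (_ : _ * _ / e ^+ 2 = 64 * ((a + 1) / a) * (M ^+ 2 / e ^+ 2 / a)); last first.
  by field; rewrite !gt_eqF//; lra.
rewrite (_ : 128 * _ / _ / a = 64 * 2 * (M ^+ 2 / e ^+ 2 / a)); last first.
  by field; rewrite !gt_eqF.
rewrite ler_wpM2r//.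
  by rewrite !divr_ge0 ?sqr_ge0 ?ltW.
by rewrite ler_wpM2l// ler_pdivrMr//; lra.
Qed.

End concentration.

(** * The Gaussian kernel and the energy kernel *)

Section gaussian_kernel.
Context {R : realType} {dx dy dz : nat}.
Local Notation obs := (obs R dx dy dz).
Local Notation XT := (dx.-tuple R).

Lemma measurable_sqdist n :
  measurable_fun setT (fun p : n.-tuple R * n.-tuple R => sqdist p.1 p.2).
Proof.
apply: measurable_sum => i; apply: measurable_funX; apply: measurable_funB.
  by apply: (measurableT_comp (measurable_tnth i)).
by apply: (measurableT_comp (measurable_tnth i)).
Qed.

Lemma sqdistC n (u v : n.-tuple R) : sqdist u v = sqdist v u.
Proof. by apply: eq_bigr => i _; rewrite -sqrrN opprB. Qed.

Lemma sqdist_ge0 n (u v : n.-tuple R) : 0 <= sqdist u v.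
Proof. by apply: sumr_ge0 => i _; exact: sqr_ge0. Qed.

Lemma measurable_obsX : measurable_fun setT (@obsX R dx dy dz).
Proof. exact: measurableT_comp. Qed.

Lemma measurable_obsY : measurable_fun setT (@obsY R dx dy dz).
Proof. exact: (measurableT_comp measurable_snd measurable_fst). Qed.

Lemma measurable_obsZ : measurable_fun setT (@obsZ R dx dy dz).
Proof. exact: measurable_snd. Qed.

Lemma measurable_with_x :
  measurable_fun setT (fun p : obs * XT => with_x p.1 p.2).
Proof.
apply: measurable_fun_pair; first apply: measurable_fun_pair => //.
  exact: (measurableT_comp measurable_obsY).
exact: (measurableT_comp measurable_obsZ).
Qed.

Variable sigma : R.
Local Notation K := (@gauss_kernel R dx dy dz sigma).

Lemma measurable_gauss_kernel :
  measurable_fun setT (fun p : obs * obs => K p.1 p.2).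
Proof.
have mq n (f : obs -> n.-tuple R) : measurable_fun setT f ->
    measurable_fun setT (fun p : obs * obs => sqdist (f p.1) (f p.2)).
  move=> mf; have mff : measurable_fun setT (fun p : obs * obs => (f p.1, f p.2)).
    by apply: measurable_fun_pair; exact: (measurableT_comp mf).
  exact: (measurableT_comp (@measurable_sqdist n) mff).
apply: (measurableT_comp (@measurable_expR R)).
apply: measurable_funN; apply: measurable_funM => //.
apply: measurable_funM => //; apply: measurable_funD; first apply: measurable_funD.
- exact: (mq _ _ measurable_obsX).
- exact: (mq _ _ measurable_obsY).
- exact: (mq _ _ measurable_obsZ).
Qed.

Lemma gauss_kernelC v w : K v w = K w v.
Proof.
rewrite /gauss_kernel (sqdistC (obsX v)) (sqdistC (obsY v)).
by rewrite (sqdistC (obsZ v)).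
Qed.

Lemma gauss_kernel_norm v w : `|K v w| <= 1.
Proof.
rewrite ger0_norm ?expR_ge0// -[leRHS]expR0 ler_expR oppr_le0.
by rewrite divr_ge0// mulr_ge0 ?sqr_ge0// !addr_ge0 ?sqdist_ge0.
Qed.

Lemma bdd_mfun_gauss_kernel : bdd_mfun (fun p : obs * obs => K p.1 p.2).
Proof.
by split; [exact: measurable_gauss_kernel|exists 1 => p; exact: gauss_kernel_norm].
Qed.

(** A sample point is paired with a draw; [energy] is the kernel of the
    U-statistic [zeta_hat] in these pairs. *)
Definition energy (p q : obs * XT) : R :=
  K p.1 q.1 + K (with_x p.1 p.2) (with_x q.1 q.2)
  - K p.1 (with_x q.1 q.2) - K (with_x p.1 p.2) q.1.

Lemma energy_norm p q : `|energy p q| <= 4.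
Proof.
rewrite /energy.
have := gauss_kernel_norm p.1 q.1.
have := gauss_kernel_norm (with_x p.1 p.2) (with_x q.1 q.2).
have := gauss_kernel_norm p.1 (with_x q.1 q.2).
have := gauss_kernel_norm (with_x p.1 p.2) q.1.
rewrite !ler_norml => /andP[? ?] /andP[? ?] /andP[? ?] /andP[? ?].
by apply/andP; split; lra.
Qed.

Lemma bdd_mfun_energy : bdd_mfun (fun z : (obs * XT) * (obs * XT) => energy z.1 z.2).
Proof.
have b (f g : (obs * XT) * (obs * XT) -> obs) : measurable_fun setT f ->
    measurable_fun setT g -> bdd_mfun (fun z => K (f z) (g z)).
  move=> mf mg; apply: (bdd_mfun_comp bdd_mfun_gauss_kernel (h := fun z => (f z, g z))).
  exact: measurable_fun_pair.
have m1 : measurable_fun setT (fun z : (obs * XT) * (obs * XT) => z.1.1).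
  exact: measurableT_comp.
have m2 : measurable_fun setT (fun z : (obs * XT) * (obs * XT) => z.2.1).
  exact: (measurableT_comp measurable_fst).
have m1' : measurable_fun setT
    (fun z : (obs * XT) * (obs * XT) => with_x z.1.1 z.1.2).
  exact: (measurableT_comp measurable_with_x).
have m2' : measurable_fun setT
    (fun z : (obs * XT) * (obs * XT) => with_x z.2.1 z.2.2).
  exact: (measurableT_comp measurable_with_x).
by apply: bdd_mfunB; [apply: bdd_mfunB; [apply: bdd_mfunD|]|]; exact: b.
Qed.

Lemma zeta_hat_ustat n (V : n.-tuple obs) (X1 : n.-tuple XT) :
  zeta_hat sigma V X1 =
  ustat (fun i j z => energy (tnth V i, z.1) (tnth V j, z.2)) X1.
Proof. by []. Qed.

End gaussian_kernel.

(** * Conditional means under the true conditional law *)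

Section resampling.
Context {R : realType} {dx dy dz : nat}.
Local Notation obs := (obs R dx dy dz).
Local Notation XT := (dx.-tuple R).
Variable PXZ : R.-pker dz.-tuple R ~> dx.-tuple R.
Local Notation mu v := (kernel_prob PXZ (obsZ v)).

Lemma measurable_family_kernel_prob {d} {T : measurableType d} d1 d2
    (T1 : measurableType d1) (T2 : measurableType d2)
    (k : R.-pker T1 ~> T2) (f : T -> T1) : measurable_fun setT f ->
  measurable_family (fun t => kernel_prob k (f t)).
Proof.
by move=> mf U mU; exact: (measurableT_comp (measurable_kernel k _ mU) mf).
Qed.

(** [resample1] and [resample2] replace the X-block of one argument by an
    independent draw from the true conditional law and average over this draw. *)
Definition resample2 (f : obs * obs -> R) (p : obs * obs) : R :=
  \int[mu p.2]_y f (p.1, with_x p.2 y).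

Definition resample1 (f : obs * obs -> R) (p : obs * obs) : R :=
  \int[mu p.1]_x f (with_x p.1 x, p.2).

Lemma bdd_mfun_resample1 f : bdd_mfun f -> bdd_mfun (resample1 f).
Proof.
move=> bf.
have mk : measurable_family (fun p : obs * obs => mu p.1).
  apply: measurable_family_kernel_prob.
  exact: (measurableT_comp measurable_obsZ).
apply: (bdd_mfun_mean_family mk
  (f := fun z => f (with_x z.1.1 z.2, z.1.2))).
apply: bdd_mfun_comp => //; apply: measurable_fun_pair.
  have m : measurable_fun setT (fun z : (obs * obs) * XT => (z.1.1, z.2)).
    by apply: measurable_fun_pair => //; exact: (measurableT_comp measurable_fst).
  exact: (measurableT_comp measurable_with_x m).
exact: (measurableT_comp measurable_snd).
Qed.

Lemma bdd_mfun_resample2 f : bdd_mfun f -> bdd_mfun (resample2 f).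
Proof.
move=> bf.
have mk : measurable_family (fun p : obs * obs => mu p.2).
  apply: measurable_family_kernel_prob.
  exact: (measurableT_comp measurable_obsZ).
apply: (bdd_mfun_mean_family mk
  (f := fun z => f (z.1.1, with_x z.1.2 z.2))).
apply: bdd_mfun_comp => //; apply: measurable_fun_pair.
  exact: (measurableT_comp measurable_fst).
have m : measurable_fun setT (fun z : (obs * obs) * XT => (z.1.2, z.2)).
  by apply: measurable_fun_pair => //; exact: (measurableT_comp measurable_snd).
exact: (measurableT_comp measurable_with_x m).
Qed.

Lemma measurable_with_x_at (v : obs) : measurable_fun setT (with_x v).
Proof.
exact: (measurableT_comp measurable_with_x (pair1_measurable v)).
Qed.

Lemma null_expectation_EFin (P : probability obs R) (f : obs -> R) :
  bdd_mfun f ->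
  null_expectation P PXZ (fun v => (f v)%:E) =
  (\int[P]_v \int[mu v]_x f (with_x v x))%:E.
Proof.
move=> bf; rewrite /null_expectation -EFin_Rintegral; last first.
  have mk : measurable_family (fun v : obs => mu v).
    by apply: measurable_family_kernel_prob; exact: measurable_obsZ.
  apply: (bdd_mfun_mean_family mk (f := fun z => f (with_x z.1 z.2))).
  by apply: bdd_mfun_comp => //; exact: measurable_with_x.
apply: eq_integral => v _; rewrite -(EFin_Rintegral (mu v))//.
by apply: bdd_mfun_comp => //; exact: measurable_with_x_at.
Qed.

Variable sigma : R.
Local Notation K := (@gauss_kernel R dx dy dz sigma).
Local Notation K2 := (fun p : obs * obs => K p.1 p.2).

(** The mean of the energy kernel given the two sample points. *)
Definition cond_energy (p : obs * obs) : R :=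
  \int[mu p.1]_x \int[mu p.2]_y energy sigma (p.1, x) (p.2, y).

Lemma cond_energyE p : cond_energy p =
  K2 p + resample1 (resample2 K2) p - resample2 K2 p - resample1 K2 p.
Proof.
case: p => v w; rewrite /cond_energy /=.
have bK := @bdd_mfun_gauss_kernel R dx dy dz sigma.
have bKa a : bdd_mfun (fun y => K a (with_x w y)).
  apply: (bdd_mfun_comp bK (h := fun y => (a, with_x w y))).
  apply: measurable_fun_pair => //; exact: measurable_with_x_at.
have bKb b : bdd_mfun (fun x => K (with_x v x) b).
  apply: (bdd_mfun_comp bK (h := fun x => (with_x v x, b))).
  apply: measurable_fun_pair => //; exact: measurable_with_x_at.
have bR : bdd_mfun (fun x => resample2 K2 (with_x v x, w)).
  apply: (bdd_mfun_comp (bdd_mfun_resample2 bK) (h := fun x => (with_x v x, w))).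
  apply: measurable_fun_pair => //; exact: measurable_with_x_at.
have c1 (c : R) : bdd_mfun (fun _ : XT => c) by exact: bdd_mfun_cst.
transitivity (\int[mu v]_x (K v w + resample2 K2 (with_x v x, w)
    - resample2 K2 (v, w) - K (with_x v x) w)).
  apply: eq_Rintegral => x _; rewrite /energy/=.
  by rewrite mean_DBB// !mean_cst.
by rewrite mean_DBB// !mean_cst.
Qed.

Lemma bdd_mfun_cond_energy : bdd_mfun cond_energy.
Proof.
rewrite (funext cond_energyE).
have bK := @bdd_mfun_gauss_kernel R dx dy dz sigma.
have b1 := bdd_mfun_resample1 bK; have b2 := bdd_mfun_resample2 bK.
have b12 := bdd_mfun_resample1 b2.
by apply: bdd_mfunB => //; apply: bdd_mfunB => //; exact: bdd_mfunD.
Qed.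

Lemma cond_energy_norm p : `|cond_energy p| <= 4.
Proof.
have bE (x : XT) : bdd_mfun (fun y => energy sigma (p.1, x) (p.2, y)).
  apply: (bdd_mfun_comp (@bdd_mfun_energy R dx dy dz sigma) (h := fun y => ((p.1, x), (p.2, y)))).
  by apply: measurable_fun_pair => //; exact: pair1_measurable.
apply: mean_norm_le => [|x]; last first.
  by apply: mean_norm_le => // y; exact: energy_norm.
apply: (bdd_mfun_mean2 (mu p.2)
  (f := fun z => energy sigma (p.1, z.1) (p.2, z.2))).
apply: (bdd_mfun_comp (@bdd_mfun_energy R dx dy dz sigma)
  (h := fun z : XT * XT => ((p.1, z.1), (p.2, z.2)))).
by do 2 apply: measurable_fun_pair => //.
Qed.

(** The two cross terms have the same mean, by symmetry of the Gaussian kernel,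
    whence the factor 2 of [zeta]; the doubly resampled term requires integrating
    over the first draw before the second sample point, again by Fubini. *)
Lemma mean_cond_energy (P : probability obs R) :
  \int[P]_v \int[P]_w cond_energy (v, w) = zeta sigma P PXZ.
Proof.
have bK := @bdd_mfun_gauss_kernel R dx dy dz sigma.
have b1 := bdd_mfun_resample1 bK; have b2 := bdd_mfun_resample2 bK.
have b12 := bdd_mfun_resample1 b2.
have bm (f : obs * obs -> R) (bf : bdd_mfun f) := bdd_mfun_mean2 P bf.
have bs (f : obs * obs -> R) v : bdd_mfun f -> bdd_mfun (fun w => f (v, w)).
  by move=> bf; apply: bdd_mfun_comp => //; exact: pair1_measurable.
have -> : zeta sigma P PXZ = \int[P]_v \int[P]_w K2 (v, w)
    + \int[P]_v \int[mu v]_x \int[P]_w resample2 K2 (with_x v x, w)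
    - 2 * \int[P]_v \int[P]_w resample2 K2 (v, w).
  rewrite /zeta.
  have E1 : (\int[P]_v \int[P]_w (K v w)%:E)%E = (\int[P]_v \int[P]_w K v w)%:E.
    rewrite -EFin_Rintegral; last exact: bm _ bK.
    by apply: eq_integral => v _; rewrite EFin_Rintegral//; exact: bs _ v bK.
  have E2 v : null_expectation P PXZ (fun w => (K v w)%:E) =
      (\int[P]_w resample2 K2 (v, w))%:E.
    by rewrite null_expectation_EFin//; exact: bs _ v bK.
  rewrite E1; under [X in (_ + null_expectation _ _ X - _)%E]eq_fun do rewrite E2.
  rewrite null_expectation_EFin; last exact: bm _ b2.
  under [X in (_ - _ * X)%E]eq_integral do rewrite E2.
  by rewrite EFin_Rintegral//; exact: bm _ b2.
have S1 : \int[P]_v \int[P]_w resample1 K2 (v, w) =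
    \int[P]_v \int[P]_w resample2 K2 (v, w).
  rewrite (mean_swap P P b1); apply: eq_Rintegral => w _.
  apply: eq_Rintegral => v _; apply: eq_Rintegral => x _ /=.
  exact: gauss_kernelC.
have S12 v : \int[P]_w resample1 (resample2 K2) (v, w) =
    \int[mu v]_x \int[P]_w resample2 K2 (with_x v x, w).
  apply: (esym (mean_swap (mu v) P (f := fun z => resample2 K2 (with_x v z.1, z.2)) _)).
  have m : measurable_fun setT (fun z : XT * obs => (with_x v z.1, z.2)).
    apply: measurable_fun_pair; last exact: measurable_snd.
    exact: (measurableT_comp (measurable_with_x_at v) measurable_fst).
  exact: (bdd_mfun_comp b2 m).
transitivity (\int[P]_v (\int[P]_w K2 (v, w)
    + \int[P]_w resample1 (resample2 K2) (v, w)
    - \int[P]_w resample2 K2 (v, w) - \int[P]_w resample1 K2 (v, w))).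
  apply: eq_Rintegral => v _; rewrite -(mean_DBB P (bs _ v bK) (bs _ v b12)
    (bs _ v b2) (bs _ v b1)).
  by apply: eq_Rintegral => w _; exact: cond_energyE.
rewrite (mean_DBB P (bm _ bK) (bm _ b12) (bm _ b2) (bm _ b1)) S1.
rewrite (eq_Rintegral _ (fun v _ => S12 v)).
by ring.
Qed.

End resampling.

(** * Total variation, outer measure and the law of the sample *)

Lemma le_dTV {R : realType} {d} {T : measurableType d} (mu nu : probability T R)
    (A : set T) (e : R) : measurable A -> dTV mu nu <= e ->
  (mu A <= nu A + e%:E)%E.
Proof.
move=> mA mue.
have fmu : mu A \is a fin_num by exact: fin_num_measure.
have fnu : nu A \is a fin_num by exact: fin_num_measure.
have h01 (m : probability T R) B : measurable B -> 0 <= fine (m B) <= 1.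
  move=> mB; have fm : m B \is a fin_num by exact: fin_num_measure.
  by rewrite -!lee_fin fineK// measure_ge0 probability_le1.
have : `|fine (mu A) - fine (nu A)| <= e.
  apply: le_trans mue; apply: ub_le_sup; last by exists A.
  exists 1 => _ [B mB <-].
  have /andP[a0 a1] := h01 mu B mB; have /andP[b0 b1] := h01 nu B mB.
  by rewrite ler_norml; apply/andP; split; lra.
rewrite ler_norml => /andP[_ h].
by rewrite -(fineK fmu) -(fineK fnu) -EFinD lee_fin -lerBlDl.
Qed.

(** The event that the total variation distance is large need not be measurable:
    it is replaced by a measurable event of nearly the same size. *)
Lemma mu_ext_measurable_cover {R : realType} {d} {T : measurableType d}
    (P : probability T R) (A : set T) (x : \bar R) : (mu_ext P A < x)%E ->
  exists B, [/\ measurable B, A `<=` B & (P B < x)%E].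
Proof.
move=> /ereal_inf_lt[_ [F [mF AF] <-] Fx]; exists (\bigcup_k F k).
have mU : measurable (\bigcup_k F k) by exact: bigcupT_measurable.
by split => //; apply: le_lt_trans Fx; exact: measure_sigma_subadditive.
Qed.

Lemma measurable_sample {R : realType} {d d'} {Om : measurableType d}
    {T : measurableType d'} (Pr : probability Om R) (V : nat -> {RV Pr >-> T}) n :
  measurable_fun setT (fun w => [tuple V i w | i < n]).
Proof.
apply/measurable_fun_tnthP => i.
rewrite (_ : _ \o _ = V i); first exact: measurable_funPT.
by apply/funext => w /=; rewrite tnth_mktuple.
Qed.

Lemma sample_law {R : realType} {d d'} {Om : measurableType d}
    {T : measurableType d'} (Pr : probability Om R) (V : nat -> {RV Pr >-> T})
    (P : probability T R) n : iid_with_law V P ->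
  forall B : set (n.-tuple T), measurable B ->
    Pr [set w | B [tuple V i w | i < n]] = prod_prob (fun _ : 'I_n => P) B.
Proof.
move=> [lawV indV] B mB.
pose H := isMeasurableFun.Build _ _ _ _ _ (@measurable_sample _ _ _ _ _ _ V n).
pose S : {mfun Om >-> n.-tuple T} := HB.pack (fun w => [tuple V i w | i < n]) H.
rewrite -(@prod_prob_unique _ _ _ _ (fun _ : 'I_n => P) (distribution Pr S))// => A mA.
(* the hypothesis is about families indexed by nat: extend [A] by [setT] *)
pose A' k := if insub k is Some i then A i else setT : set T.
have A'E (i : 'I_n) : A' i = A i by rewrite /A' valK.
pose J := seq_fset tt (iota 0 n).
change (Pr (S @^-1` rectangle A) = \prod_(i < n) P (A i))%E.
rewrite (_ : _ @^-1` _ = \bigcap_(i in [set` J]) V i @^-1` A' i); last first.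
  apply/seteqP; split => [w /= Aw k|w Aw i].
    rewrite /= seq_fsetE mem_iota/= add0n => kn.
    have := Aw (Ordinal kn); rewrite tnth_mktuple -A'E.
    by [].
  rewrite tnth_mktuple -A'E; apply: (Aw (val i)).
  by rewrite /= seq_fsetE mem_iota/= add0n.
rewrite indV; last by move=> k; rewrite /A'; case: insubP.
transitivity (\prod_(i <- iota 0 n) P (A' i))%E.
  rewrite (perm_big (iota 0 n)); last first.
    apply: uniq_perm; [exact: fset_uniq|exact: iota_uniq|].
    by move=> k; rewrite seq_fsetE.
  apply: eq_bigr => k _; apply: lawV.
  by rewrite /A'; case: insubP.
rewrite -[in LHS](subn0 n) -/(index_iota 0 n) big_mkord.
by apply: eq_bigr => i _; rewrite A'E.
Qed.

(** * Tail bound for the statistic *)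

Lemma sum_pairs_cst {R : realType} n (c : R) :
  \sum_(i < n) \sum_(j < n | (i < j)%N) c = 'C(n, 2)%:R * c.
Proof.
rewrite (exchange_big_dep xpredT)//=.
rewrite (eq_bigr (fun j : 'I_n => c *+ j)) => [|j _]; last first.
  rewrite -(big_ord_widen n (fun=> c)); last exact: ltnW.
  by rewrite sumr_const card_ord.
by rewrite sumrMnr mulr_natl -bin2_sum big_mkord.
Qed.

Section measurable_levels.
Context {R : realType} {d : measure_display} {T : measurableType d}.
Variables (f : T -> R) (c e : R) (mf : measurable_fun setT f).

Let mfc : measurable_fun setT (fun w => `|f w - c|).
Proof.
apply: (measurableT_comp (f := fun x : R => `|x|)) => //.
exact: measurable_funB.
Qed.

Lemma measurable_dist_gt : measurable [set w | e < `|f w - c|].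
Proof.
rewrite (_ : mkset _ = setT `&` (fun w => `|f w - c|) @^-1` `]e, +oo[).
  exact: mfc.
by rewrite setTI; apply/seteqP; split => w /=; rewrite in_itv/= andbT.
Qed.

Lemma measurable_dist_ge : measurable [set w | e <= `|f w - c|].
Proof.
rewrite (_ : mkset _ = setT `&` (fun w => `|f w - c|) @^-1` `[e, +oo[).
  exact: mfc.
by rewrite setTI; apply/seteqP; split => w /=; rewrite in_itv/= andbT.
Qed.

End measurable_levels.

Section tail_bound.
Context {R : realType} {dx dy dz : nat}.
Local Notation obs := (obs R dx dy dz).
Local Notation XT := (dx.-tuple R).
Variables (sigma : R) (P : probability obs R)
  (PXZ : R.-pker dz.-tuple R ~> dx.-tuple R).
Let zeta0 := zeta sigma P PXZ.

(** The mean of [zeta_hat] given the sample, for draws from the true conditional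
    law (see [mean_zeta_hat]). *)
Definition cond_zeta_hat n (v : n.-tuple obs) : R :=
  ustat (fun _ _ => cond_energy PXZ sigma) v.

Lemma mean_zeta_hat n (v : n.-tuple obs) :
  \int[prod_prob (fun i => kernel_prob PXZ (obsZ (tnth v i)))]_x
    zeta_hat sigma v x = cond_zeta_hat v.
Proof.
under eq_Rintegral do rewrite zeta_hat_ustat.
rewrite (mean_ustat (M := 4))//= => [|i j [x y]]; last exact: energy_norm.
move=> i j; have [mE _] := @bdd_mfun_energy R dx dy dz sigma.
have m : measurable_fun setT (fun z : XT * XT => ((tnth v i, z.1), (tnth v j, z.2))).
  by do 2 apply: measurable_fun_pair => //.
exact: (measurableT_comp mE m).
Qed.

Let rate (m : nat) (e : R) : R := 128 * 4 ^+ 2 / (e / 2) ^+ 2 / m.+1%:R.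

Lemma zeta_hat_concentration m (v : m.+2.-tuple obs) (e : R) : 0 < e ->
  (prod_prob (fun i => kernel_prob PXZ (obsZ (tnth v i)))
     [set x | (e / 2 <= `|zeta_hat sigma v x - cond_zeta_hat v|)%R]
   <= (rate m e)%:E)%E.
Proof.
move=> e0; rewrite -mean_zeta_hat.
have := @ustat_concentration R _ XT m
  (fun i j z => energy sigma (tnth v i, z.1) (tnth v j, z.2)) 4 (e / 2)
  (fun i => kernel_prob PXZ (obsZ (tnth v i))).
apply.
- move=> i j; have [mE _] := @bdd_mfun_energy R dx dy dz sigma.
  have k : measurable_fun setT (fun z : XT * XT => ((tnth v i, z.1), (tnth v j, z.2))).
    by do 2 apply: measurable_fun_pair => //.
  exact: (measurableT_comp mE k).
- by move=> i j z; exact: energy_norm.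
- by rewrite divr_gt0.
Qed.

Lemma cond_zeta_hat_concentration m (e : R) : 0 < e ->
  (prod_prob (fun _ : 'I_m.+2 => P)
     [set v | (e / 2 <= `|cond_zeta_hat v - zeta0|)%R] <= (rate m e)%:E)%E.
Proof.
move=> e0.
have [mE _] := @bdd_mfun_cond_energy R dx dy dz PXZ sigma.
have -> : zeta0 = \int[prod_prob (fun _ : 'I_m.+2 => P)]_v cond_zeta_hat v.
  rewrite (mean_ustat (M := 4))// => [|i j z]; last exact: cond_energy_norm.
  rewrite mean_cond_energy sum_pairs_cst mulKf//.
  by rewrite pnatr_eq0 -lt0n bin_gt0.
apply: (ustat_concentration (M := 4)) => //; last by rewrite divr_gt0.
by move=> i j z; exact: cond_energy_norm.
Qed.

Lemma measurable_zeta_hat n :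
  measurable_fun setT (fun p : n.-tuple obs * n.-tuple XT => zeta_hat sigma p.1 p.2).
Proof.
apply: measurable_funM => //.
have [mE _] := @bdd_mfun_energy R dx dy dz sigma.
have mij (i j : 'I_n) : measurable_fun setT (fun p : n.-tuple obs * n.-tuple XT =>
    energy sigma (tnth p.1 i, tnth p.2 i) (tnth p.1 j, tnth p.2 j)).
  have m1 k : measurable_fun setT
      (fun p : n.-tuple obs * n.-tuple XT => tnth p.1 k).
    exact: (measurableT_comp (measurable_tnth k) measurable_fst).
  have m2 k : measurable_fun setT
      (fun p : n.-tuple obs * n.-tuple XT => tnth p.2 k).
    exact: (measurableT_comp (measurable_tnth k) measurable_snd).
  have m : measurable_fun setT (fun p : n.-tuple obs * n.-tuple XT =>
      ((tnth p.1 i, tnth p.2 i), (tnth p.1 j, tnth p.2 j))).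
    by do 2 apply: measurable_fun_pair.
  exact: (measurableT_comp mE m).
apply: measurable_sum => i.
under eq_fun do rewrite big_mkcond/=.
by apply: measurable_sum => j; case: (i < j)%N; [exact: mij|exact: measurable_cst].
Qed.

Lemma measurable_cond_zeta_hat n : measurable_fun setT (@cond_zeta_hat n).
Proof.
have [mE _] := @bdd_mfun_cond_energy R dx dy dz PXZ sigma.
have hM (i j : 'I_n) (z : obs * obs) : `|cond_energy PXZ sigma z| <= 4.
  exact: cond_energy_norm.
by have [] := @bdd_mfun_ustat R _ obs n _ 4 (fun _ _ => mE) hM.
Qed.

Variables (d : measure_display) (Omega : measurableType d)
  (Pr : probability Omega R) (V : nat -> {RV Pr >-> obs})
  (V_iid : iid_with_law V P).
Variables (dS : measure_display) (S : measurableType dS) (n : nat).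
Variables (U : {RV Pr >-> S})
  (Q : R.-pker (n.-tuple obs * S) * dz.-tuple R ~> dx.-tuple R)
  (X1 : {RV Pr >-> n.-tuple XT}).
Let sample w := [tuple V i w | i < n].
Let data w := (sample w, U w).
Let QXZ w (i : 'I_n) := kernel_prob Q (data w, obsZ (V i w)).
Let PXZi w (i : 'I_n) := kernel_prob PXZ (obsZ (V i w)).

(** Off [N], exchanging the estimated and the true product law costs [dl]; off the
    event [D] that [cond_zeta_hat] is far from its mean, the event considered forces
    [zeta_hat] to be far from its conditional mean. The bound [c] is provided by
    the two concentration lemmas. *)
Lemma zeta_hat_tail (e dl c : R) (N : set Omega) :
  (forall v : n.-tuple obs,
    (prod_prob (fun i => kernel_prob PXZ (obsZ (tnth v i)))
      [set x | (e / 2 <= `|zeta_hat sigma v x - cond_zeta_hat v|)%R] <= c%:E)%E) ->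
  (prod_prob (fun _ : 'I_n => P)
    [set v | (e / 2 <= `|cond_zeta_hat v - zeta0|)%R] <= c%:E)%E ->
  0 <= c -> 0 < e -> 0 <= dl -> drawn_given Pr data X1 QXZ -> measurable N ->
  (forall w, ~ N w -> dTV (prod_prob (QXZ w)) (prod_prob (PXZi w)) <= dl) ->
  (Pr [set w | (e < `|zeta_hat sigma (sample w) (X1 w) - zeta0|)%R] <=
     (dl + 2 * c)%:E + Pr N)%E.
Proof.
move=> condc meanc c0 e0 dl0 X1_drawn mN NdTV.
pose q (u : n.-tuple obs * S) (i : 'I_n) : probability XT R :=
  kernel_prob Q (u, obsZ (tnth u.1 i)).
pose p (v : n.-tuple obs) (i : 'I_n) : probability XT R :=
  kernel_prob PXZ (obsZ (tnth v i)).
have qE w : prod_prob (q (data w)) = prod_prob (QXZ w).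
  by congr prod_prob; apply/funext => i; rewrite /q /= tnth_mktuple.
have pE w : prod_prob (p (sample w)) = prod_prob (PXZi w).
  by congr prod_prob; apply/funext => i; rewrite /p tnth_mktuple.
have mdata : measurable_fun setT data.
  by apply: measurable_fun_pair;
    [exact: (@measurable_sample _ _ _ _ _ _ V n)|exact: measurable_funPT].
have mq : measurable_family (fun u => prod_prob (q u)).
  apply: measurable_family_prod_prob => i; apply: measurable_family_kernel_prob.
  apply: measurable_fun_pair => //; apply: (measurableT_comp measurable_obsZ).
  exact: (measurableT_comp (measurable_tnth i) measurable_fst).
pose B := [set z : (n.-tuple obs * S) * n.-tuple XT |
  e < `|zeta_hat sigma z.1.1 z.2 - zeta0|].
have mB : measurable B.
  have m1 : measurable_fun setT
      (fun z : (n.-tuple obs * S) * n.-tuple XT => (z.1.1, z.2)).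
    by apply: measurable_fun_pair => //; exact: (measurableT_comp measurable_fst).
  have mz := measurableT_comp (@measurable_zeta_hat n) m1.
  exact: (measurable_dist_gt _ _ mz).
pose D := [set w | e / 2 <= `|cond_zeta_hat (sample w) - zeta0|].
have mD0 : measurable [set v : n.-tuple obs | e / 2 <= `|cond_zeta_hat v - zeta0|].
  exact: (measurable_dist_ge _ _ (@measurable_cond_zeta_hat n)).
have mD : measurable D.
  rewrite -[X in measurable X]setTI.
  exact: (@measurable_sample _ _ _ _ _ _ V n measurableT _ mD0).
have PrD : (Pr D <= c%:E)%E.
  by have := sample_law V_iid mD0; rewrite -/sample -/D => ->.
(* the bound on the conditional probability of the event given the data *)
pose r w : R := dl + c + (\1_N w + \1_D w).
have br : bdd_mfun r.
  apply: bdd_mfunD; first exact: bdd_mfun_cst.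
  by apply: bdd_mfunD; exact: bdd_mfun_indic.
have -> : Pr [set w | e < `|zeta_hat sigma (sample w) (X1 w) - zeta0|]
    = (\int[Pr]_w prod_prob (q (data w)) (xsection B (data w)))%E.
  apply: (joint_prob_family mdata (measurable_funPT X1) mq _ mB).
  move=> A C mA mC; rewrite (X1_drawn A C mA mC).
  by apply: eq_integral => w _; rewrite -qE.
apply: (@le_trans _ _ (\int[Pr]_w (r w)%:E)%E).
  apply: ge0_le_integral => //.
  - exact: (measurableT_comp (measurable_family_xsection mq mB) mdata).
  - by apply/measurable_EFinP; case: br.
  move=> w _; have mBw : measurable (xsection B (data w)) by exact: measurable_xsection.
  have le1 x : 1 <= x -> (prod_prob (q (data w)) (xsection B (data w)) <= x%:E)%E.
    by move=> x1; rewrite (le_trans (probability_le1 _ mBw))// lee_fin.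
  rewrite /r !indicE; have [wN|wN] := boolP (w \in N).
    by apply: le1; rewrite addrC -addrA lerDl !addr_ge0.
  have [wD|wD] := boolP (w \in D); first by apply: le1; rewrite add0r lerDr addr_ge0.
  rewrite !addr0.
  have NwN : ~ N w by move: wN; rewrite notin_setE.
  apply: (le_trans (le_dTV mBw (_ : dTV _ (prod_prob (p (sample w))) <= dl))).
    by rewrite qE pE; exact: NdTV.
  rewrite [dl + c]addrC EFinD; apply: leeD2r.
  apply: le_trans (condc (sample w)).
  apply: le_measure; rewrite ?inE//.
    have mz : measurable_fun setT (zeta_hat sigma (sample w)).
      exact: (measurableT_comp (@measurable_zeta_hat n) (pair1_measurable (sample w))).
    exact: (measurable_dist_ge _ _ mz).
  move=> x; rewrite xsectionE => xB.
  have {xB} ezh : e < `|zeta_hat sigma (sample w) x - zeta0| by exact: xB.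
  move: wD; rewrite notin_setE/D/= => /negP; rewrite -ltNge => wD.
  have := ler_distD (cond_zeta_hat (sample w)) (zeta_hat sigma (sample w) x) zeta0.
  by lra.
rewrite EFin_Rintegral// /r meanD; last 2 first.
- exact: bdd_mfun_cst.
- by apply: bdd_mfunD; exact: bdd_mfun_indic.
rewrite mean_cst meanD; [|exact: bdd_mfun_indic|exact: bdd_mfun_indic].
move: PrD; rewrite -(mean_indic Pr mD) -(mean_indic Pr mN) -EFinD !lee_fin => PrD.
by lra.
Qed.

End tail_bound.

(** * Consistency *)

Theorem proposition5p1 (R : realType) (dx dy dz : nat) (sigma : R)
  (sigma2_gt0 : 0 < sigma ^+ 2)
  (* the law P of (X, Y, Z) and the conditional law of X given Z *)
  (P : probability (obs R dx dy dz) R)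
  (PXZ : R.-pker dz.-tuple R ~> dx.-tuple R)
  (PXZ_cond : is_cond_dist P obsX obsZ PXZ)
  (H1 : ~ cond_independent P obsX obsY obsZ)
  (* the i.i.d. sample *)
  (d : measure_display) (Omega : measurableType d) (Pr : probability Omega R)
  (V : nat -> {RV Pr >-> obs R dx dy dz})
  (V_iid : iid_with_law V P)
  (* further data (e.g. an auxiliary sample) available to the estimate *)
  (dS : nat -> measure_display) (S : forall n, measurableType (dS n))
  (U : forall n, {RV Pr >-> S n})
  (* the estimate of PXZ computed from the sample and the further data *)
  (Q : forall n,
     R.-pker (n.-tuple (obs R dx dy dz) * S n) * dz.-tuple R ~> dx.-tuple R)
  (X1 : forall n, {RV Pr >-> n.-tuple (dx.-tuple R)}) :
  let sample n w := [tuple V i w | i < n] in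
  let data n w := (sample n w, U n w) in
  let QXZ n w (i : 'I_n) := kernel_prob (Q n) (data n w, obsZ (V i w)) in
  let PXZi n w (i : 'I_n) := kernel_prob PXZ (obsZ (V i w)) in
  (forall n, drawn_given Pr (data n) (X1 n) (QXZ n)) ->
  cvg_in_probability Pr
    (fun n w => dTV (prod_prob (QXZ n w)) (prod_prob (PXZi n w))) 0 ->
  cvg_in_probability Pr
    (fun n w => zeta_hat sigma (sample n w) (X1 n w)) (zeta sigma P PXZ).
Proof.
move=> sample data QXZ PXZi X1_drawn dTV0 e e0.
pose A n := [set w | e < `|zeta_hat sigma (sample n w) (X1 n w) - zeta sigma P PXZ|].
have mA n : measurable (A n).
  have m : measurable_fun setT (fun w => (sample n w, X1 n w)).
    apply: measurable_fun_pair; last exact: measurable_funPT.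
    exact: (@measurable_sample _ _ _ _ _ _ V n).
  have mz := measurableT_comp (@measurable_zeta_hat R dx dy dz sigma n) m.
  exact: (measurable_dist_gt _ _ mz).
rewrite (_ : (fun n => _) = fun n => (fine (Pr (A n)))%:E); last first.
  by apply/funext => n; rewrite fineK ?fin_num_measure// -measurable_mu_extE.
apply: cvg_EFin; first exact: nearW.
apply/cvgrPdist_le => /= eta eta0.
(* one third each for the total variation error, the exceptional event where it
   is large, and the two concentration bounds *)
pose dl := eta / 3.
have dl0 : 0 < dl by rewrite divr_gt0.
have dTV_small : \forall n \near \oo,
    (mu_ext Pr [set w | (dl < `|dTV (prod_prob (QXZ n w)) (prod_prob (PXZi n w)) - 0|)%R]
     < dl%:E)%E.
  have dlE : (0 < dl%:E)%E by rewrite lte_fin.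
  exact: (dTV0 dl dl0 _ (open_ereal_lt' dlE)).
pose C : R := 2 * (128 * 4 ^+ 2 / (e / 2) ^+ 2).
near=> n.
have n2 : (2 <= n)%N by near: n; exact: nbhs_infty_ge.
have Cn : C / dl + 1 < n%:R by near: n; exact: nbhs_infty_gtr.
have [N [mN dTVN PrN]] : exists N, [/\ measurable N,
    [set w | dl < `|dTV (prod_prob (QXZ n w)) (prod_prob (PXZi n w)) - 0|] `<=` N
    & (Pr N < dl%:E)%E].
  by apply: mu_ext_measurable_cover; near: n.
have tail : (Pr (A n) <= (dl + dl)%:E + Pr N)%E.
  have NdTV w : ~ N w ->
      dTV (prod_prob (QXZ n w)) (prod_prob (PXZi n w)) <= dl.
    move=> Nw; rewrite leNgt; apply/negP => h; apply: Nw; apply: dTVN => /=.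
    by rewrite subr0 (lt_le_trans h)// ler_norm.
  pose c := 128 * 4 ^+ 2 / (e / 2) ^+ 2 / n.-1%:R : R.
  have c0 : 0 <= c by rewrite !divr_ge0 ?sqr_ge0.
  apply: (@le_trans _ _ ((dl + 2 * c)%:E + Pr N)%E).
    apply: (zeta_hat_tail V_iid _ _ c0 e0 (ltW dl0) (X1_drawn n) mN NdTV).
      move=> v; rewrite /c; clear - n2 e0 v.
      by case: n n2 v => [//|[//|m]] _ v; exact: zeta_hat_concentration.
    rewrite /c; clear - n2 e0.
    by case: n n2 => [//|[//|m]] _; exact: cond_zeta_hat_concentration.
  apply: leeD2r; rewrite lee_fin lerD2l.
  have n1 : n.-1%:R = n%:R - 1 :> R by rewrite -subn1 natrB// ltnW.
  have n1_gt0 : 0 < n.-1%:R :> R by rewrite ltr0n -ltnS prednK// ltnW.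
  rewrite /c mulrA -/C ler_pdivrMr// mulrC -ler_pdivrMr// n1.
  by lra.
have fA : fine (Pr (A n)) <= dl + dl + fine (Pr N).
  by rewrite -lee_fin EFinD !fineK ?fin_num_measure.
have fN : fine (Pr N) <= dl by rewrite -lee_fin fineK ?fin_num_measure// ltW.
rewrite sub0r normrN ger0_norm ?fine_ge0//.
have -> : eta = dl + dl + dl by rewrite /dl; field.
by lra.
Unshelve. all: by end_near.
Qed.
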